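(* If $c$ is real with $0\le c\le 1/4$, then $r_{\mathrm{bif}}(c)=1/4-c$.
   Context: $f_c(z)=z^2+c$, extended to $\widehat{\mathbb{C}}$ by $f_c(\infty)=\infty$. For $c\in\mathbb{C}$, $r\ge0$, $G_{c,r}$ is the semigroup under composition generated by $\{f_{c'}:|c'-c|\le r\}$. A minimal set of a polynomial semigroup $G$ is a minimal element, with respect to inclusion, of the family of non-empty compact $L\subset\widehat{\mathbb{C}}$ with $g(L)\subset L$ for all $g\in G$; it is planar if $\infty\notin L$. The bifurcation radius $r_{\mathrm{bif}}(c)$ is the supremum of those $r\ge0$ for which $G_{c,r}$ has a planar minimal set (equivalently the infimum of those $r\ge0$ for which $G_{c,r}$ has no planar minimal set); by prior work this value is attained and $G_{c,r}$ has a planar minimal set iff $r\le r_{\mathrm{bif}}(c)$. *)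

(* Defs.v *)
From HB Require Import structures.
From mathcomp Require Import all_boot all_order all_algebra.
From mathcomp Require Import all_classical all_reals all_analysis.
From mathcomp Require Import complex.
Set Implicit Arguments. Unset Strict Implicit. Unset Printing Implicit Defensive.
Import Order.TTheory GRing.Theory Num.Theory.
Import numFieldTopology.Exports.
Local Open Scope classical_set_scope.
Local Open Scope ring_scope.
Local Open Scope complex_scope.

(* The complex plane C = R[i] with its norm topology, and the Riemann sphere
   as its one-point compactification (None = infinity). *)
Definition Csphere (R : realType) := one_point_compactification (R[i])^o.

Definition fquad (R : realType) (c : R[i]) (z : Csphere R) : Csphere R :=
  match z with
  | Some w => Some (w ^+ 2 + c : (R[i])^o)
  | None => None
  end.

Inductive Gsemi (R : realType) (c : R[i]) (r : R) :
    (Csphere R -> Csphere R) -> Prop :=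
  | Gsemi_gen (c' : R[i]) : `|c' - c| <= r%:C -> Gsemi c r (fquad c')
  | Gsemi_comp g h : Gsemi c r g -> Gsemi c r h -> Gsemi c r (g \o h).

Definition invariant_compact (R : realType)
    (G : (Csphere R -> Csphere R) -> Prop) (L : set (Csphere R)) : Prop :=
  L !=set0 /\ compact L /\ (forall g, G g -> g @` L `<=` L).

Definition minimal_set (R : realType)
    (G : (Csphere R -> Csphere R) -> Prop) (L : set (Csphere R)) : Prop :=
  invariant_compact G L /\
  (forall L', invariant_compact G L' -> L' `<=` L -> L' = L).

Definition planar_minimal_set (R : realType)
    (G : (Csphere R -> Csphere R) -> Prop) (L : set (Csphere R)) : Prop :=
  minimal_set G L /\ ~ L None.

Definition rbif (R : realType) (c : R[i]) : R :=
  sup [set r : R | 0 <= r /\ exists L, planar_minimal_set (Gsemi c r) L].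

(* Main.v *)
Require Import Defs.
From mathcomp Require Import all_boot all_order all_algebra.
From mathcomp Require Import all_classical all_reals all_analysis.
From mathcomp Require Import complex ring lra.
Import Order.TTheory GRing.Theory Num.Theory.
Import numFieldTopology.Exports.
Import Normc.
Local Open Scope classical_set_scope.
Local Open Scope ring_scope.
Local Open Scope complex_scope.

Set Implicit Arguments.
Unset Strict Implicit.
Unset Printing Implicit Defensive.

(** If [x + r <= 1/4], the disc [|z| <= 1/2] is mapped into itself by every
    generator, and Zorn's lemma yields a minimal set inside it.  Let
    [x + r > 1/4] and let [A] be a non-empty invariant subset of the plane; then
    [A] is unbounded.  A real point of [A] escapes to infinity under
    [t |-> t ^ 2 + x + r], and a point of the disc [|z| <= 1/2] can be steered
    to the real line.  If [A] avoids this disc, squaring is expanding on [A]: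
    when [A] contains the disc of centre [w] and radius [rho], the squares of
    its points cover the disc of centre [w ^ 2] and radius [rho], hence [A]
    contains the disc of centre [w ^ 2 + x] and radius [rho + r], and so on. *)

Lemma exists_natmul_gt (R : archiRealFieldType) (d M : R) : 0 < d ->
  exists n : nat, M < n%:R * d.
Proof.
move=> d_gt0; exists (Num.truncn (M / d)).+1.
by rewrite -ltr_pdivrMr//; exact: truncnS_gt.
Qed.

Lemma exists_convex_split (R : realFieldType) (p r t : R) :
  0 <= p -> 0 <= r -> t <= p + r ->
  exists k, [/\ 0 <= k, k <= 1, k * t <= p & (1 - k) * t <= r].
Proof.
move=> p_ge0 r_ge0 t_le; have [s_gt0|s_le0] := ltP 0 (p + r); last first.
  by exists 0; split; lra.
have ratio_le1 : t / (p + r) <= 1 by rewrite ler_pdivrMr// mul1r.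
exists (p / (p + r)); split.
- by rewrite divr_ge0// ltW.
- by rewrite ler_pdivrMr//; lra.
- by rewrite mulrAC -mulrA ler_piMr.
- have -> : (1 - p / (p + r)) * t = r * (t / (p + r)) by field; lra.
  by rewrite ler_piMr.
Qed.

Section ComplexModulus.
Variable R : rcfType.
Implicit Types (p rho t : R) (u v w y z : R[i]).

Lemma normc_ge0 z : 0 <= normc z.
Proof. by case: z => a b; exact: sqrtr_ge0. Qed.

Lemma normc_distC y z : normc (y - z) = normc (z - y).
Proof. exact: (@distrC _ (Rcomplex R)). Qed.

Lemma normc_real t : normc t%:C = `|t|.
Proof. by rewrite /= expr0n addr0 sqrtr_sqr. Qed.

Lemma normc_imaginary t : normc (0 +i* t) = `|t|.
Proof. by rewrite /= expr0n add0r sqrtr_sqr. Qed.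

Lemma ler_normc y z :
  `|complex.Re y| <= `|complex.Re z| -> `|complex.Im y| <= `|complex.Im z| ->
  normc y <= normc z.
Proof.
case: y z => [a b] [c d] /= ac bd; apply: ler_wsqrtr.
rewrite -(real_normK (num_real a)) -(real_normK (num_real b)).
rewrite -(real_normK (num_real c)) -(real_normK (num_real d)).
by rewrite lerD// lerXn2r ?nnegrE.
Qed.

Lemma ler_Re_normc z : `|complex.Re z| <= normc z.
Proof. by rewrite -normc_real ler_normc//= normr0. Qed.

Lemma ler_Im_normc z : `|complex.Im z| <= normc z.
Proof. by rewrite -normc_imaginary ler_normc//= normr0. Qed.

Lemma norm_Im_sqr z :
  `|complex.Im (z ^+ 2)| = 2 * `|complex.Re z| * `|complex.Im z|.
Proof.
rewrite -[2 in RHS](@normr_nat R) -!normrM; congr `|_|.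
by case: z => a b; rewrite expr2; simpc => /=; ring.
Qed.

Definition cdisc w rho : set R[i] := [set z | normc (z - w) <= rho].

Lemma cdiscDl w u rho : cdisc w rho (w + u) = (normc u <= rho) :> Prop.
Proof. by rewrite /cdisc/mkset addrAC subrr add0r. Qed.

Lemma cdisc_center w rho : 0 <= rho -> cdisc w rho w.
Proof. by move=> rho_ge0; rewrite -[X in cdisc _ _ X]addr0 cdiscDl normc0. Qed.

Lemma cdisc0 w : cdisc w 0 = [set w].
Proof.
apply/seteqP; split=> [z /= zw|_ ->]; last exact: cdisc_center.
by apply: subr0_eq; apply: eq0_normc; apply/le_anti; rewrite zw normc_ge0.
Qed.

Lemma cdisc_split w1 w2 rho1 rho2 z :
  0 <= rho1 -> 0 <= rho2 -> cdisc (w1 + w2) (rho1 + rho2) z ->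
  exists2 u, cdisc w1 rho1 u & cdisc w2 rho2 (z - u).
Proof.
move=> rho1_ge0 rho2_ge0 zw; pose v := z - (w1 + w2).
have [k [k_ge0 k_le1 kv k'v]] := exists_convex_split rho1_ge0 rho2_ge0 zw.
exists (w1 + k%:C * v); first by rewrite cdiscDl normcM normc_real ger0_norm.
have -> : z - (w1 + k%:C * v) = w2 + (1 - k)%:C * v.
  by rewrite /v rmorphB rmorph1; ring.
by rewrite cdiscDl normcM normc_real ger0_norm// subr_ge0.
Qed.

Lemma cdisc_center_far p rho w :
  0 <= p -> 0 <= rho -> (forall z, cdisc w rho z -> p < normc z) ->
  p + rho < normc w.
Proof.
move=> p_ge0 rho_ge0 far; rewrite ltNge; apply/negP => w_le.
have [k [k_ge0 k_le1 kw k'w]] := exists_convex_split p_ge0 rho_ge0 w_le.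
have /far : cdisc w rho (k%:C * w).
  rewrite /cdisc/= normc_distC -[X in X - _]mul1r -mulrBl -(rmorphB _ 1 k).
  by rewrite normcM normc_real ger0_norm// subr_ge0.
by rewrite normcM normc_real ger0_norm// ltNge kw.
Qed.

Lemma exists_closer_sqrtc v w :
  exists2 y, y ^+ 2 = v & normc (y - w) <= normc (y + w).
Proof.
have [closer|/ltW closer] := leP (normc (sqrtc v - w)) (normc (sqrtc v + w)).
  by exists (sqrtc v); rewrite ?sqr_sqrtc.
exists (- sqrtc v); first by rewrite sqrrN sqr_sqrtc.
have -> : - sqrtc v - w = - (sqrtc v + w) by rewrite opprD.
have -> : - sqrtc v + w = - (sqrtc v - w) by rewrite opprB addrC.
by rewrite (normcN (_ + _ : Rcomplex R)) (normcN (_ - _ : Rcomplex R)).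
Qed.

Lemma cdisc_sub_image_sqr w rho :
  cdisc (w ^+ 2) (rho * (2 * normc w - rho)) `<=`
  (fun z => z ^+ 2) @` cdisc w rho.
Proof.
move=> v vw; have [y yv closer] := exists_closer_sqrtc v w.
exists y => //; rewrite /cdisc/= leNgt; apply/negP => y_far.
have prod_le : normc (y - w) * normc (y + w) <= rho * (2 * normc w - rho).
  by rewrite -normcM -subr_sqr yv.
have sum_ge : 2 * normc w <= normc (y - w) + normc (y + w).
  rewrite (normc_distC y w) addrC; apply: le_trans (le_normcD (y + w) (w - y)).
  have -> : y + w + (w - y) = w *+ 2 by rewrite mulr2n; ring.
  by rewrite normcMn mulr_natl.
have w_ge0 := normc_ge0 w; have p_ge0 := normc_ge0 (y - w).
(* The function [p |-> p (2 |w| - p)] increases up to [p = |w|], where it takes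
   its maximum [|w| ^ 2]. *)
have [near_w|far_w] := leP (normc (y - w)) (normc w).
  have : 0 < (normc (y - w) - rho) * (2 * normc w - normc (y - w) - rho).
    by apply: mulr_gt0; lra.
  by nra.
by have := sqr_ge0 (normc w - rho); nra.
Qed.

End ComplexModulus.

Section QuadraticStable.
Variable R : rcfType.
Implicit Types (A : set R[i]) (c w z : R[i]) (q r rho x : R).

Definition quadratic_stable c r A :=
  forall z c', A z -> cdisc c r c' -> A (z ^+ 2 + c').

Lemma half_disc_stable c r : normc c + r <= 1 / 4 ->
  quadratic_stable c r [set z | normc z <= 1 / 2].
Proof.
move=> cr z c' /= z_le c'_le.
have c'_quarter : normc c' <= 1 / 4.
  have := le_normcD (c' - c) c; rewrite subrK; move: c'_le; rewrite /cdisc/=.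
  by lra.
apply: le_trans (le_normcD _ _) _; rewrite expr2 normcM.
by have := normc_ge0 z; nra.
Qed.

Lemma stable_cdisc_growth c r A w rho : 0 <= r -> 0 <= rho ->
  1 + rho <= 2 * normc w -> quadratic_stable c r A -> cdisc w rho `<=` A ->
  cdisc (w ^+ 2 + c) (rho + r) `<=` A.
Proof.
move=> r_ge0 rho_ge0 w_far Ast wA z /cdisc_split[]// u uw zu.
have [y /wA Ay yu] : ((fun z => z ^+ 2) @` cdisc w rho) u.
  by apply: cdisc_sub_image_sqr; apply: le_trans uw _; nra.
by rewrite -(subrK u z) addrC -yu; apply: Ast => //; rewrite yu.
Qed.

(* The parameter [c'] cancels the part [1 - k] of the imaginary part of the next
   iterate; [|Im (z ^ 2)| = 2 |Re z| |Im z| <= |Im z|] in the disc. *)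
Lemma stable_half_disc_lower_Im x r q A z :
  `|x| <= 1 / 4 -> 0 <= r -> 0 <= q -> quadratic_stable x%:C r A ->
  A z -> normc z <= 1 / 2 -> `|complex.Im z| <= q + r ->
  exists y, [/\ A y, normc y <= 1 / 2 & `|complex.Im y| <= q].
Proof.
move=> x_le r_ge0 q_ge0 Ast Az z_le Im_z.
have w_le : normc (z ^+ 2 + x%:C) <= 1 / 2.
  apply: (@half_disc_stable x%:C 0) z_le (cdisc_center _ _) => //.
  by rewrite normc_real addr0.
have Im_w : `|complex.Im (z ^+ 2 + x%:C)| <= q + r.
  rewrite raddfD/= addr0 norm_Im_sqr.
  by have := ler_Re_normc z; have := normr_ge0 (complex.Im z); nra.
case wE : (z ^+ 2 + x%:C) w_le Im_w => [a b] w_le /= b_le.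
have [k [k_ge0 k_le1 kb k'b]] := exists_convex_split q_ge0 r_ge0 b_le.
exists (a +i* (k * b)); split.
- have -> : a +i* (k * b) = z ^+ 2 + (x%:C + (0 +i* (- ((1 - k) * b)))).
    by rewrite addrA wE; simpc; congr (_ +i* _); ring.
  apply: Ast => //; rewrite cdiscDl normc_imaginary normrN normrM.
  by rewrite ger0_norm// subr_ge0.
- apply: le_trans w_le; apply: ler_normc => //=.
  by rewrite normrM ger0_norm// ler_piMl.
- by rewrite /= normrM ger0_norm.
Qed.

Lemma stable_half_disc_real x r A z (n : nat) :
  `|x| <= 1 / 4 -> 0 <= r -> quadratic_stable x%:C r A ->
  A z -> normc z <= 1 / 2 -> `|complex.Im z| <= n%:R * r ->
  exists t, A t%:C.
Proof.
move=> x_le r_ge0 Ast; elim: n z => [|n IH] z Az z_le.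
  rewrite mul0r normr_le0 => /eqP Im_z0; exists (complex.Re z).
  by case: z Az Im_z0 {z_le} => a b /[swap] /= ->.
rewrite -natr1 mulrDl mul1r => Im_z.
have nr_ge0 : 0 <= n%:R * r by rewrite mulr_ge0.
have [y [Ay y_le Im_y]] :=
  stable_half_disc_lower_Im x_le r_ge0 nr_ge0 Ast Az z_le Im_z.
exact: IH Im_y.
Qed.

End QuadraticStable.

Section Escape.
Variable R : realType.
Implicit Types (A : set R[i]) (c : R[i]) (r t x : R).

Definition normc_unbounded A := forall M : R, exists2 z, A z & M < normc z.

Lemma stable_real_point_unbounded x r A t :
  0 <= r -> 1 / 4 < x + r -> quadratic_stable x%:C r A -> A t%:C ->
  normc_unbounded A.
Proof.
move=> r_ge0 xr Ast At M; have d_gt0 : 0 < x + r - 1 / 4 by lra.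
have grow n : exists2 s : R, A s%:C & t + n%:R * (x + r - 1 / 4) <= s.
  elim: n => [|n [s As ts]]; first by exists t; rewrite // mul0r addr0.
  exists (s ^+ 2 + (x + r)).
    rewrite rmorphD rmorphXn/=; apply: Ast => //.
    by rewrite rmorphD cdiscDl normc_real ger0_norm.
  by rewrite -natr1 mulrDl mul1r; have := sqr_ge0 (s - 1 / 2); nra.
have [n Mn] := exists_natmul_gt (M - t) d_gt0; have [s As ts] := grow n.
by exists s%:C => //; rewrite normc_real; have := ler_norm s; lra.
Qed.

Lemma stable_far_unbounded c r A :
  0 < r -> quadratic_stable c r A -> (forall z, A z -> 1 / 2 < normc z) ->
  A !=set0 -> normc_unbounded A.
Proof.
move=> r_gt0 Ast Afar [z0 Az0] M; have r_ge0 := ltW r_gt0.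
have nr_ge0 n : 0 <= n%:R * r by rewrite mulr_ge0.
have center_far n w : cdisc w (n%:R * r) `<=` A -> 1 / 2 + n%:R * r < normc w.
  by move=> wA; apply: cdisc_center_far => // z /wA /Afar.
have grow n : exists w, cdisc w (n%:R * r) `<=` A.
  elim: n => [|n [w wA]]; first by exists z0; rewrite mul0r cdisc0 => _ ->.
  exists (w ^+ 2 + c); rewrite -natr1 mulrDl mul1r.
  apply: stable_cdisc_growth => //.
  by have := center_far _ _ wA; have := nr_ge0 n; lra.
have [n Mn] := exists_natmul_gt M r_gt0; have [w wA] := grow n.
exists w; first by apply: wA; exact: cdisc_center.
by have := center_far _ _ wA; lra.
Qed.

Lemma stable_unbounded x r A :
  `|x| <= 1 / 4 -> 1 / 4 < x + r -> quadratic_stable x%:C r A ->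
  A !=set0 -> normc_unbounded A.
Proof.
move=> x_le xr Ast A0; have r_gt0 : 0 < r by have := ler_norm x; lra.
have [[z Az z_le]|/forall2NP far] :=
    pselect (exists2 z, A z & normc z <= 1 / 2).
  have [n /ltW Im_z] := exists_natmul_gt `|complex.Im z| r_gt0.
  have [t] := stable_half_disc_real x_le (ltW r_gt0) Ast Az z_le Im_z.
  exact: stable_real_point_unbounded (ltW r_gt0) xr Ast.
apply: stable_far_unbounded r_gt0 Ast _ A0 => z Az.
by case: (far z) => // /negP; rewrite -ltNge.
Qed.

End Escape.

Section ComplexTopology.
Variable R : realType.

Lemma norm_normc (z : R[i]) : `|z| = (normc z)%:C.
Proof. by []. Qed.

Lemma normc_continuous : continuous (fun z : (R[i])^o => normc z).
Proof.
move=> z; apply/cvgrPdist_lt => [|e e_gt0]; first exact: nbhs_filter.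
exists e%:C => [|y]; rewrite /= ?norm_normc ltcR//.
exact: le_lt_trans (@ler_dist_dist _ (Rcomplex R) z y).
Qed.

Lemma real_complex_continuous : continuous (fun t : R => t%:C : (R[i])^o).
Proof.
move=> t; apply/cvgrPdist_lt => -[e e'].
rewrite ltcE /= => /andP[/eqP -> e_gt0].
apply/nbhs_ballP; exists e => // s ts.
by rewrite -rmorphB norm_normc ltcR normc_real.
Qed.

Lemma complex_pair_continuous :
  continuous (fun p : R * R => (p.1 +i* p.2 : (R[i])^o)).
Proof.
move=> p; rewrite (_ : (fun p => _) = fun p => p.1%:C + 'i * p.2%:C : (R[i])^o).
  apply: cvgD; last apply: cvgMr.
    by apply: cvg_comp; [exact: cvg_fst|exact: real_complex_continuous].
  by apply: cvg_comp; [exact: cvg_snd|exact: real_complex_continuous].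
by apply/funext => q; exact: complexE.
Qed.

Lemma closed_normc_le (M : R) : closed [set z : (R[i])^o | normc z <= M].
Proof. exact: preimage_closed (in1W normc_continuous) (@closed_le R M). Qed.

Lemma compact_normc_bounded (A : set (R[i])^o) :
  compact A -> exists M : R, forall z, A z -> normc z <= M.
Proof.
move=> /(continuous_compact (continuous_subspaceT normc_continuous)).
case/compact_bounded => M [_ normA_le]; exists (M + 1) => z Az.
rewrite -[normc z]ger0_norm ?normc_ge0//.
by apply: (normA_le (M + 1)); [rewrite ltrDl|exists z].
Qed.

Lemma compact_normc_le (M : R) : compact [set z : (R[i])^o | normc z <= M].
Proof.
have square_compact : compact (`[- M, M] `*` `[- M, M] : set (R * R)).
  by apply: compact_setX; exact: segment_compact.
have image_compact := continuous_compact
  (continuous_subspaceT complex_pair_continuous) square_compact.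
apply: (subclosed_compact (@closed_normc_le M) image_compact) => -[a b] /= z_le.
exists (a, b) => //=; rewrite !in_itv/= -!ler_norml.
split; apply: le_trans z_le; first exact: (ler_Re_normc (a +i* b)).
exact: (ler_Im_normc (a +i* b)).
Qed.

Lemma locally_compact_complex : locally_compact [set: (R[i])^o].
Proof.
move=> z _; rewrite withinET.
exists [set y | normc y <= normc z + 1]; last first.
  by split; [exact: compact_normc_le|exact: closed_normc_le].
by apply: (cvgr_le (normc z) (@normc_continuous z)); rewrite ltrDl.
Qed.

Lemma hausdorff_Csphere : hausdorff_space (Csphere R).
Proof.
apply: one_point_compactification_hausdorff; last exact: norm_hausdorff.
exact: locally_compact_complex.
Qed.

End ComplexTopology.

Lemma Zorn_bigcap T (P : set (set T)) (K : set T) : P K ->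
  (forall F, F !=set0 -> F `<=` P -> total_on F subset ->
     P (\bigcap_(A in F) A)) ->
  exists2 L, P L /\ L `<=` K & forall L', P L' -> L' `<=` L -> L' = L.
Proof.
move=> PK Pcap.
have [F FP Ftot|U [PU Umax]] :=
    @Zorn_bigcup T [set U | P (K `\` U)]; last first.
  exists (K `\` U); first by split=> // z [].
  move=> L' PL' L'U; apply/seteqP; split=> // z [Kz nUz].
  apply: contrapT => nL'z; apply: (Umax (~` L')).
    by split=> [y Uy /L'U[]|/(_ z nL'z)].
  by rewrite /= setDE setCK setIidr// => y /L'U[].
have [->|/set0P F0] := eqVneq F set0; first by rewrite /= bigcup_set0 setD0.
rewrite /= -bigcupDr// -(bigcap_image F (setD K) id); apply: Pcap.
- by case: F0 => U FU; exists (K `\` U), U.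
- by move=> _ [U FU <-]; exact: FP.
- move=> _ _ [U FU <-] [V FV <-].
  by have [UV|VU] := Ftot _ _ FU FV; [right|left]; exact: setDS.
Qed.

Lemma bigcap_chain_compact_neq0 (X : topologicalType) (F : set (set X)) :
  hausdorff_space X -> F !=set0 -> total_on F subset ->
  (forall A, F A -> A !=set0 /\ compact A) -> \bigcap_(A in F) A !=set0.
Proof.
move=> hX [A0 FA0] Ftot Fcompact.
have F_proper : ProperFilter (filter_from F id).
  apply: filter_from_proper; last by move=> A /Fcompact[].
  apply: filter_from_filter => [|A B FA FB]; first by exists A0.
  have [AB|BA] := Ftot _ _ FA FB.
    by exists A => // z Az; split=> //; exact: AB.
  by exists B => // z Bz; split=> //; exact: BA.
have [_ A0_compact] := Fcompact _ FA0.
have [|p [_]] := A0_compact _ F_proper; first by exists A0.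
rewrite clusterE => p_clos; exists p => A FA.
have [_ /(compact_closed hX)/closure_id->] := Fcompact _ FA.
by apply: p_clos; exists A.
Qed.

Lemma closed_preimage_some_sub_compact (X : topologicalType)
    (L : set (one_point_compactification X)) :
  closed L -> ~ L None -> exists2 K, compact K & Some @^-1` L `<=` K.
Proof.
move=> clL LN; have : nbhs (None : one_point_compactification X) (~` L).
  by apply: open_nbhs_nbhs; split=> //; exact: closed_openC.
case=> K [cK _] KL; exists K => // z Lz; apply: contrapT => nKz.
by apply: (KL (Some z)) Lz; left; exists z.
Qed.

Section PlanarMinimalSets.
Variable R : realType.
Implicit Types (G : (Csphere R -> Csphere R) -> Prop) (K L : set (Csphere R)).
Implicit Types (c : R[i]) (r x : R).

Lemma invariant_compact_bigcap G (F : set (set (Csphere R))) :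
  F !=set0 -> total_on F subset -> F `<=` invariant_compact G ->
  invariant_compact G (\bigcap_(A in F) A).
Proof.
move=> [A0 FA0] Ftot Finv; have [_ [A0_compact _]] := Finv _ FA0.
split; [|split].
- apply: bigcap_chain_compact_neq0 Ftot _; first exact: hausdorff_Csphere.
    by exists A0.
  by move=> A /Finv[A_neq0 []].
- apply: (subclosed_compact _ A0_compact); last by move=> z; exact.
  apply: closed_bigI => A /Finv[_ [A_compact _]].
  exact: (compact_closed (@hausdorff_Csphere R)).
- move=> g Gg _ [z zF <-] A FA; have [_ [_ Ainv]] := Finv _ FA.
  by apply: (Ainv g Gg); exists z => //; exact: zF.
Qed.

Lemma exists_minimal_set G K :
  invariant_compact G K -> exists2 L, minimal_set G L & L `<=` K.
Proof.
move=> Kinv; have [|L [Linv LK] Lmin] := Zorn_bigcap Kinv; last by exists L.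
by move=> F F_neq0 Finv Ftot; exact: invariant_compact_bigcap.
Qed.

Lemma invariant_compact_image_some c r (A : set (R[i])^o) :
  A !=set0 -> compact A -> quadratic_stable c r A ->
  invariant_compact (Gsemi c r) (Some @` A).
Proof.
move=> [z0 Az0] A_compact Ast; split; first by exists (Some z0), z0.
split.
  apply: continuous_compact A_compact; apply: continuous_subspaceT.
  exact: one_point_compactification_some_continuous.
move=> g; elim=> [c' c'_near _ [_ [z Az <-] <-]|g1 g2 _ IH1 _ IH2 _ [z Az <-]].
  rewrite norm_normc lecR in c'_near.
  by exists (z ^+ 2 + c') => //; exact: Ast.
by apply: IH1; exists (g2 z) => //; apply: IH2; exists z.
Qed.

Lemma quadratic_stable_preimage_some c r L :
  invariant_compact (Gsemi c r) L -> quadratic_stable c r (Some @^-1` L).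
Proof.
move=> [_ [_ Linv]] z c' Lz c'_near.
apply: (Linv (fquad c')); last by exists (Some z).
by apply: Gsemi_gen; rewrite norm_normc lecR.
Qed.

Lemma planar_minimal_set_exists c r : normc c + r <= 1 / 4 ->
  exists L, planar_minimal_set (Gsemi c r) L.
Proof.
move=> cr; have disc_neq0 : [set z : R[i] | normc z <= 1 / 2] !=set0.
  by exists 0; rewrite /mkset normc0.
have [L Lmin LK] := exists_minimal_set (invariant_compact_image_some
  disc_neq0 (@compact_normc_le R (1 / 2)) (half_disc_stable cr)).
by exists L; split=> // /LK[].
Qed.

Lemma planar_invariant_compact_radius_le x r L : `|x| <= 1 / 4 ->
  invariant_compact (Gsemi x%:C r) L -> ~ L None -> x + r <= 1 / 4.
Proof.
move=> x_le Linv LN; rewrite leNgt; apply/negP => xr.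
have [L_neq0 [L_compact _]] := Linv.
have L_closed := compact_closed (@hausdorff_Csphere R) L_compact.
have [K K_compact LK] := closed_preimage_some_sub_compact L_closed LN.
have [M K_le] := compact_normc_bounded K_compact.
have L_stable := quadratic_stable_preimage_some Linv.
have [|z Lz] := stable_unbounded x_le xr L_stable _ M.
  by case: L_neq0 => -[z|//] Lz; exists z.
by rewrite ltNge K_le//; exact: LK.
Qed.

Lemma planar_minimal_set_iff x r : 0 <= x <= 1 / 4 ->
  (exists L, planar_minimal_set (Gsemi x%:C r) L) <-> r <= 1 / 4 - x.
Proof.
move=> /andP[x_ge0 x_le]; split=> [[L [[Linv _] LN]]|r_le].
  rewrite lerBrDl; apply: planar_invariant_compact_radius_le Linv LN.
  by rewrite ger0_norm.
by apply: planar_minimal_set_exists; rewrite normc_real ger0_norm// -lerBrDl.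
Qed.

End PlanarMinimalSets.

Theorem theorem4p12 (R : realType) (x : R) :
  0 <= x -> x <= 1 / 4 -> rbif (x%:C : R[i]) = 1 / 4 - x.
Proof.
move=> x_ge0 x_le; rewrite /rbif -[RHS](@sup_itvcc R 0) ?subr_ge0//.
congr sup; apply/seteqP; split=> r /=; rewrite in_itv/=.
  by move=> [r_ge0 /planar_minimal_set_iff->]; rewrite ?r_ge0 ?x_ge0.
move=> /andP[r_ge0 r_le]; split=> //; apply/planar_minimal_set_iff => //.
by rewrite x_ge0.
Qed.
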